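(* For every integer $n\geq 3$, the saltire graph ${SA}_{n,n}$ is claw-contractible-free and its chromatic symmetric function $X_{{SA}_{n,n}}$ is not $e$-positive.
   Context: All graphs are finite and simple. For a graph $G$ with vertex set $V=\{v_1,\dots,v_N\}$, the chromatic symmetric function is $X_G=\sum_\kappa x_{\kappa(v_1)}\cdots x_{\kappa(v_N)}$, summed over all proper colourings $\kappa:V\to\{1,2,\dots\}$ (adjacent vertices receive different colours). The elementary symmetric functions are $e_i=\sum_{j_1<\cdots<j_i}x_{j_1}\cdots x_{j_i}$ and $e_\lambda=e_{\lambda_1}\cdots e_{\lambda_\ell}$ for a partition $\lambda$; they form a basis of the algebra of symmetric functions. A symmetric function is $e$-positive if it is a non-negative linear combination of the $e_\lambda$. The claw is $K_{1,3}$. A graph $G$ contracts to the claw if there is a subset $S$ of its edges such that contracting all edges of $S$ (identifying endpoints) and replacing multiple edges by single edges yields the claw; $G$ is claw-contractible-free if it does not contract to the claw. For $a,b\geq 2$, the saltire graph ${SA}_{a,b}$ is the graph on vertices $v_1,\dots,v_{a+b}$ with edges $v_iv_{i+1}$ for $1\leq i\leq a+b-1$, together with $v_{a+b}v_1$, $v_1v_{a+1}$ and $v_2v_{a+2}$. *)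

(* Defs.v *)
From HB Require Import structures.
From mathcomp Require Import all_boot all_order all_fingroup all_algebra.
From mathcomp Require Import mpoly.

Set Implicit Arguments.
Unset Strict Implicit.
Unset Printing Implicit Defensive.

Import Order.TTheory GRing.Theory Num.Theory.

Local Open Scope ring_scope.

Record sgraph := SGraph {
  vertex :> finType;
  adj : rel vertex;
  adj_sym : ssrbool.symmetric adj;
  adj_irr : irreflexive adj
}.

(* The simple graph whose edges are the pairs {x, y} with x != y that are
   listed by r in at least one direction. *)
Section GraphOf.
Variables (T : finType) (r : rel T).

Definition sym_adj : rel T := fun x y => (x != y) && (r x y || r y x).

Lemma sym_adj_sym : ssrbool.symmetric sym_adj.
Proof. by move=> x y; rewrite /sym_adj eq_sym orbC. Qed.

Lemma sym_adj_irr : irreflexive sym_adj.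
Proof. by move=> x; rewrite /sym_adj eqxx. Qed.

Definition graph_of : sgraph := SGraph sym_adj_sym sym_adj_irr.

End GraphOf.

Definition giso (G H : sgraph) : Prop :=
  exists2 f : G -> H, bijective f & {mono f : x y / adj x y}.

Definition edges (G : sgraph) : {set {set G}} :=
  [set [set p.1; p.2] | p : G * G & adj p.1 p.2].

Section Contraction.
Variables (G : sgraph) (S : {set {set G}}).

(* The sets of vertices that become one vertex: the classes of the equivalence
   relation generated by identifying the endpoints of every edge in S. *)
Definition contraction_blocks : {set {set G}} :=
  equivalence_partition (connect (fun x y : G => [set x; y] \in S)) [set: G].

(* Two blocks are adjacent when G has an edge between them. Parallel edges are
   merged, and graph_of discards the loops coming from edges inside a block. *)
Definition contract : sgraph :=
  @graph_of {B : {set G} | B \in contraction_blocks}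
    (fun B C => [exists x in val B, exists y in val C, adj x y]).

End Contraction.

Definition contracts_to (G H : sgraph) : Prop :=
  exists2 S : {set {set G}}, S \subset edges G & giso (contract S) H.

(* K_{1,3}, with centre 0. *)
Definition claw : sgraph :=
  @graph_of 'I_4 (fun i j => (i == 0 :> nat) && (j != 0 :> nat)).

Definition claw_contractible_free (G : sgraph) : Prop := ~ contracts_to G claw.

(* The vertex v_(i+1) is the ordinal i. The four clauses are the edges
   v_i v_(i+1), then v_(a+b) v_1, v_1 v_(a+1) and v_2 v_(a+2). Only meant for
   a, b >= 2, where these a + b + 2 edges are distinct and none is a loop. *)
Definition saltire (a b : nat) : sgraph :=
  @graph_of 'I_(a + b) (fun i j : 'I_(a + b) =>
    [|| j == i.+1 :> nat,
        (i == (a + b).-1 :> nat) && (j == 0 :> nat),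
        (i == 0 :> nat) && (j == a :> nat)
      | (i == 1%N :> nat) && (j == a.+1 :> nat)]).

(* x_k := 0 in a polynomial in x_0, ..., x_k. *)
Definition kill_last (k : nat) (p : {mpoly rat[k.+1]}) : {mpoly rat[k]} :=
  p \mPo [tuple if unlift ord_max i is Some j then 'X_j else 0 | i < k.+1].

(* A symmetric function in infinitely many variables x_0, x_1, ... is an element
   of the inverse limit, in the category of graded rings, of the rings of
   symmetric polynomials in x_0, ..., x_(k-1): sf k is the symmetric function
   with all variables but the first k set to 0. *)
Record symfun := SymFun {
  sf :> forall k, {mpoly rat[k]};
  sf_sym : forall k, sf k \is symmetric;
  sf_restr : forall k, kill_last (sf k.+1) = sf k;
  sf_bounded : exists d, forall k, (msize (sf k) <= d)%N
}.

Definition proper (G : sgraph) (k : nat) (c : {ffun G -> 'I_k}) : bool :=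
  [forall x, forall y, adj x y ==> (c x != c y)].

Definition csf_poly (G : sgraph) (k : nat) : {mpoly rat[k]} :=
  \sum_(c : {ffun G -> 'I_k} | proper c) \prod_(v : G) 'X_(c v).

Definition esym_poly (la : seq nat) (k : nat) : {mpoly rat[k]} :=
  \prod_(i <- la) mesym k rat i.

Section KillLast.
Variable k : nat.
Implicit Types p q : {mpoly rat[k.+1]}.

Lemma kill_lastD p q : kill_last (p + q) = kill_last p + kill_last q.
Proof. exact: comp_mpolyD. Qed.

Lemma kill_last1 : kill_last (1 : {mpoly rat[k.+1]}) = 1.
Proof. exact: comp_mpoly1. Qed.

Lemma kill_lastM p q : kill_last (p * q) = kill_last p * kill_last q.
Proof. by rewrite /kill_last; apply: (comp_mpoly_is_multiplicative _).1. Qed.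

Lemma kill_lastX (i : 'I_k.+1) :
  kill_last 'X_i = if unlift ord_max i is Some j then 'X_j else 0.
Proof. by rewrite /kill_last comp_mpolyXU -tnth_nth tnth_mktuple. Qed.

Lemma kill_last_prod (I : finType) (P : pred I) (F : I -> {mpoly rat[k.+1]}) :
  kill_last (\prod_(i | P i) F i) = \prod_(i | P i) kill_last (F i).
Proof. exact: (big_morph _ kill_lastM kill_last1). Qed.

Lemma kill_last_sum (I : finType) (P : pred I) (F : I -> {mpoly rat[k.+1]}) :
  kill_last (\sum_(i | P i) F i) = \sum_(i | P i) kill_last (F i).
Proof. exact: (big_morph _ kill_lastD (comp_mpoly0 _)). Qed.

Lemma kill_last_widen (p : {mpoly rat[k]}) : kill_last (mwiden p) = p.
Proof.
rewrite [in RHS](mpolyE p) [in LHS](mpolyE p) raddf_sum /=.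
rewrite (big_morph _ kill_lastD (comp_mpoly0 _)); apply: eq_bigr => m _.
rewrite mwidenZ /kill_last comp_mpolyZ mwidenX; congr (_ *: _).
rewrite comp_mpolyX big_ord_recr /= tnth_mktuple unlift_none.
have -> : mnmwiden m ord_max = 0%N by rewrite mnmwiden_ordmax.
rewrite expr0 mulr1 [RHS]mpolyXE_id; apply: eq_bigr => i _.
rewrite tnth_mktuple mnmwiden_widen.
have -> : widen_ord (leqnSn k) i = lift ord_max i.
  by apply: val_inj; rewrite /= /bump leqNgt ltn_ord.
by rewrite liftK.
Qed.

End KillLast.

Lemma homog_msize_le (k d : nat) (p : {mpoly rat[k]}) :
  p \is d.-homog for mdeg -> (msize p <= d.+1)%N.
Proof.
move=> /dhomogP hp; rewrite msizeE; apply/bigmax_leqP_seq => m mp _.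
by rewrite hp.
Qed.

Section ChromaticSymmetricFunction.
Variable G : sgraph.

Lemma csf_poly_sym k : csf_poly G k \is symmetric.
Proof.
apply/issymP => s; rewrite /csf_poly raddf_sum /=.
pose h (t : 'S_k) (c : {ffun G -> 'I_k}) := [ffun v => t (c v)].
have hK t : cancel (h t) (h t^-1%g).
  by move=> c; apply/ffunP => v; rewrite !ffunE permK.
rewrite [RHS](reindex (h s)) /=; last first.
  exists (h s^-1%g) => c _; first exact: hK.
  by have := hK s^-1%g c; rewrite invgK.
apply: eq_big => [c | c _].
  apply: eq_forallb => x; apply: eq_forallb => y.
  by rewrite !ffunE (inj_eq perm_inj).
rewrite rmorph_prod /=; apply: eq_bigr => v _; rewrite msymX ffunE.
congr mpolyX; apply/mnmP => i; rewrite mnmE !mnm1E.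
by rewrite (can2_eq (permK s) (permKV s)).
Qed.

Lemma csf_poly_restr k : kill_last (csf_poly G k.+1) = csf_poly G k.
Proof.
rewrite /csf_poly kill_last_sum.
pose low (c : {ffun G -> 'I_k.+1}) := [forall v, c v != ord_max].
rewrite (bigID low) /= [X in _ + X]big1 ?addr0; last first.
  move=> c /andP[_ /forallPn [v /negPn/eqP cv]].
  by rewrite kill_last_prod (bigD1 v) //= kill_lastX cv unlift_none mul0r.
pose up (c : {ffun G -> 'I_k}) : {ffun G -> 'I_k.+1} :=
  [ffun v => lift ord_max (c v)].
have up_low c : low (up c).
  by apply/forallP => v; rewrite ffunE eq_sym neq_lift.
have upI : injective up.
  move=> c d /ffunP cd; apply/ffunP => v.
  by have := cd v; rewrite !ffunE => /lift_inj.
have codom_up c : low c -> exists d, c = up d.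
  move=> /forallP lc.
  have dP v : exists j, c v == lift ord_max j.
    have := lc v; rewrite eq_sym => /unlift_some [j -> _].
    by exists j.
  exists [ffun v => xchoose (dP v)]; apply/ffunP => v; rewrite !ffunE.
  exact/eqP/(xchooseP (dP v)).
have up_proper c : proper (up c) = proper c.
  apply: eq_forallb => x; apply: eq_forallb => y.
  by rewrite !ffunE (inj_eq lift_inj).
transitivity (\sum_(c in [set up d | d in [set d | proper d]])
    kill_last (\prod_(v : G) 'X_(c v))).
  apply: eq_bigl => c; apply/andP/imsetP => [[pc lc]|[d]].
    have [d cE] := codom_up _ lc.
    by exists d; rewrite // inE -up_proper -cE.
  by rewrite inE => pd ->; rewrite up_proper up_low.
rewrite big_imset /=; last by move=> c d _ _; apply: upI.
apply: eq_big => [c|c _]; first by rewrite inE.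
rewrite kill_last_prod; apply: eq_bigr => v _.
by rewrite kill_lastX ffunE liftK.
Qed.

Lemma csf_poly_bounded : exists d, forall k, (msize (csf_poly G k) <= d)%N.
Proof.
exists #|G|.+1 => k; apply: homog_msize_le.
rewrite /csf_poly; apply: rpred_sum => c _.
suff -> : \prod_(v : G) 'X_(c v) = 'X_[\sum_(v : G) U_(c v)%MM] :> {mpoly rat[k]}.
  rewrite dhomogX /= mdeg_sum (eq_bigr (fun=> 1%N)) ?sum1_card //.
  by move=> v _; rewrite mdeg1.
by rewrite mprodXE.
Qed.

Definition csf : symfun := SymFun csf_poly_sym csf_poly_restr csf_poly_bounded.

End ChromaticSymmetricFunction.

Section Elementary.
Variable la : seq nat.

Lemma esym_poly_sym k : esym_poly la k \is symmetric.
Proof. by apply: rpred_prod => i _; apply: mesym_sym. Qed.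

Lemma esym_poly_restr k : kill_last (esym_poly la k.+1) = esym_poly la k.
Proof.
rewrite /esym_poly (big_morph _ (@kill_lastM k) (@kill_last1 k)).
apply: eq_bigr => -[|i] _; first by rewrite !mesym0E kill_last1.
rewrite mesymSS kill_lastD kill_lastM !kill_last_widen kill_lastX unlift_none.
by rewrite mulr0 addr0.
Qed.

Lemma esym_poly_bounded : exists d, forall k, (msize (esym_poly la k) <= d)%N.
Proof.
exists (sumn la).+1 => k; apply: homog_msize_le.
rewrite /esym_poly; elim: la => [|i s IHs]; first by rewrite big_nil dhomog1.
rewrite big_cons /=; apply: dhomogM => //.
rewrite mesymE; apply: rpred_sum => h /eqP hi.
by rewrite dhomogX /= mdeg_mesym1 hi.
Qed.

Definition esym : symfun :=
  SymFun esym_poly_sym esym_poly_restr esym_poly_bounded.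

End Elementary.

Definition is_partition (la : seq nat) : bool :=
  sorted geq la && (0%N \notin la).

(* The equality of two symmetric functions means equality in the first k
   variables for every k; the coefficients c do not depend on k. *)
Definition e_positive (f : symfun) : Prop :=
  exists (s : seq (seq nat)) (c : seq nat -> rat),
    [/\ all is_partition s,
        forall la, 0 <= c la
      & forall k, f k = \sum_(la <- s) c la *: esym la k].

(* Main.v *)
(** Claw: a contraction onto the claw yields a connected set C of vertices whose
    complement meets three pairwise nonadjacent leaf classes. Pick one vertex in
    each class; C meets each of the three arcs into which these vertices cut the
    Hamiltonian cycle, so it needs the two chords to join three arcs. But v_1, v_2
    lie in one arc and so do v_(n+1), v_(n+2), hence the chords join the same two.

    Positivity: set the first n variables to the n-th roots of unity and all the
    others to 0. Then e_i vanishes for i different from 0 and n, and e_n^2 = 1, so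
    in degree 2n only e_(n,n) survives, with value 1, and the coefficient of
    e_(n,n) in X is the sum of z^(sum of colours) over proper n-colourings.
    Transfer along the two paths with n - 2 interior vertices reduces this sum to
    the colourings of the 4-cycle v_1 v_2 v_(n+2) v_(n+1), and it equals
    - n (n - 1) (n - 2). *)

From HB Require Import structures.
From mathcomp Require Import all_boot all_order all_algebra all_field.
From mathcomp Require Import zify ring.
From mathcomp Require Import mpoly.
Require Import Defs.

Set Implicit Arguments.
Unset Strict Implicit.
Unset Printing Implicit Defensive.

Import Order.TTheory GRing.Theory Num.Theory.

(** * Contractions as vertex maps with connected fibres *)

(** The fibres of [g] are the blocks, so vertices with the same image are linked by pairs in [S];
    these pairs are edges of [G] and each stays inside one block. *)
Lemma contracts_to_map (G H : sgraph) : contracts_to G H ->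
  exists g : G -> H,
    [/\ forall i, exists x, g x = i,
        forall x y, adj x y -> g x != g y -> adj (g x) (g y)
      & forall x y, g x = g y ->
          connect (fun u v => adj u v && (g u == g v)) x y].
Proof.
case=> S SE [f [f' fK f'K] f_adj].
pose e (x y : G) := [set x; y] \in S.
have e_sym : connect_sym e.
  by apply: sym_connect_sym => x y; rewrite /e setUC.
pose blk x := [set y in [set: G] | connect e x y].
have blkP x : blk x \in contraction_blocks S by apply: imset_f.
have mem_blk x y : (y \in blk x) = connect e x y by rewrite !inE.
have blk_eq x y : connect e x y -> blk x = blk y.
  move=> xy; apply/setP => z; rewrite !mem_blk.
  exact: (same_connect e_sym xy).
pose g x := f (Sub (blk x) (blkP x)).
have gE x y : g x = g y <-> connect e x y.
  split=> [/(can_inj fK)/(congr1 val) /= bE|/blk_eq bE].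
    by rewrite -mem_blk bE mem_blk.
  by congr f; apply: val_inj.
have e_adj x y : e x y -> adj x y.
  move=> /(subsetP SE)/imsetP[[u v]]; rewrite inE /= => uv /setP xyE.
  have uv_neq : u != v by apply: contraTneq uv => ->; rewrite adj_irr.
  have xP := xyE x; have yP := xyE y; have uP := xyE u; have vP := xyE v.
  rewrite !inE !eqxx ?orbT /= in xP yP uP vP.
  case/orP: (Logic.eq_sym xP) => /eqP xE; case/orP: (Logic.eq_sym yP) => /eqP yE.
  - by move: vP uv_neq; rewrite xE yE orbb eq_sym => ->.
  - by rewrite xE yE.
  - by rewrite xE yE adj_sym.
  - by move: uP uv_neq; rewrite xE yE orbb => ->.
exists g; split=> [i|x y xy nxy|x y /gE/connectP[p]].
- case fi: (f' i) => [B BP]; have /imsetP[x _ BE] := BP.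
  exists x; rewrite -[i]f'K fi /g; congr f.
  by apply: val_inj; rewrite /= BE.
- rewrite /g f_adj /= /sym_adj; apply/andP; split.
    by apply: contraNneq nxy; rewrite /g => ->.
  apply/orP; left; apply/existsP; exists x; rewrite /= mem_blk connect0 /=.
  by apply/existsP; exists y; rewrite /= mem_blk connect0.
- elim: p x => [|z p IHp] x /=; first by move=> _ ->.
  case/andP=> xz zp yE; apply: connect_trans (IHp z zp yE).
  apply: connect1; rewrite e_adj //=; apply/eqP/gE; exact: connect1.
Qed.

(** * Adjacency in the claw and in the saltire graph *)

Lemma claw_adj (i j : claw) : adj i j = ((i == 0%N :> nat) != (j == 0%N :> nat)).
Proof. by case: i j => [[|[|[|[|i]]]] ?] [[|[|[|[|j]]]] ?]. Qed.

Lemma adj_saltire n (x y : saltire n n) : 1 < n ->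
  adj x y = [|| y == x.+1 :> nat, x == y.+1 :> nat,
    (x == (n + n).-1 :> nat) && (y == 0 :> nat),
    (y == (n + n).-1 :> nat) && (x == 0 :> nat),
    (x == 0 :> nat) && (y == n :> nat), (y == 0 :> nat) && (x == n :> nat),
    (x == 1 :> nat) && (y == n.+1 :> nat) | (y == 1 :> nat) && (x == n.+1 :> nat)].
Proof.
move=> n_gt1; rewrite /= /sym_adj -val_eqE /=.
apply/idP/idP; lia.
Qed.

Lemma saltire_adj_succ n (x y : saltire n n) : 1 < n ->
  y = x.+1 %% (n + n) :> nat -> adj x y.
Proof.
move=> n_gt1 yE; rewrite adj_saltire //; have := ltn_ord x.
have [xE|xE] := eqVneq (x : nat) (n + n).-1.
  by move=> _; rewrite yE xE prednK ?modnn ?eqxx ?orbT //; lia.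
by move=> xN; rewrite yE modn_small ?eqxx //; lia.
Qed.

(** * Arcs of the Hamiltonian cycle and the two chords *)

Lemma change_between (T : eqType) (h : nat -> T) a b : a <= b -> h a != h b ->
  exists2 i, a <= i < b & h i = h a /\ h i.+1 != h a.
Proof.
move=> ab; rewrite -(subnK ab); elim: (b - a) => [|d IHd]; first by rewrite eqxx.
rewrite addSn => nE; have [hE|nE'] := eqVneq (h a) (h (d + a)).
  by exists (d + a); [lia | rewrite -hE eq_sym].
by have [i iP iE] := IHd nE'; exists i => //; lia.
Qed.

(** [B] lists the cut vertices of the cycle and [A] marks one arc; the clauses are the chords v_1
    v_(n+1) and v_2 v_(n+2), indexed from 0. *)
Definition chord_leaves n (B : seq nat) (A : pred nat) :=
  [&& A 0 != A n, 0 \notin B & n \notin B] ||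
  [&& A 1 != A n.+1, 1 \notin B & n.+1 \notin B].

(** By the two invariance hypotheses on [A], a cycle edge avoiding [B] cannot leave [A], so only a
    chord can. *)
Lemma edge_leaves_chord n (B : seq nat) (A : pred nat) x y :
  (forall k, k \notin B -> k.+1 \notin B -> A k = A k.+1) ->
  (0 \notin B -> (n + n).-1 \notin B -> A 0 = A (n + n).-1) ->
  A x -> ~~ A y -> x \notin B -> y \notin B ->
  [|| y == x.+1, x == y.+1, (x == (n + n).-1) && (y == 0),
      (y == (n + n).-1) && (x == 0), (x == 0) && (y == n), (y == 0) && (x == n),
      (x == 1) && (y == n.+1) | (y == 1) && (x == n.+1)] -> chord_leaves n B A.
Proof.
move=> stepA closeA Ax /negPf Ay xB yB; have [AxE AyE] := (Ax, Ay).
case: eqP => [yE _|_ /=]; first by move: Ay; rewrite yE -stepA ?Ax -?yE.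
case: eqP => [xE _|_ /=]; first by move: Ax; rewrite xE -stepA ?Ay -?xE.
rewrite /chord_leaves.
case/or4P => [||/andP[/eqP xE /eqP yE]|/or3P[] /andP[/eqP xE /eqP yE]].
- by case/andP=> /eqP xE /eqP yE; move: Ay; rewrite yE closeA -?xE -?yE ?Ax.
- by case/andP=> /eqP yE /eqP xE; move: Ax; rewrite xE closeA -?xE -?yE ?Ay.
- by rewrite -xE -yE Ax Ay xB yB.
- by rewrite -xE -yE Ax Ay xB yB.
- by rewrite -xE -yE Ax Ay xB yB orbT.
- by rewrite -xE -yE Ax Ay xB yB orbT.
Qed.

(* Both chords join the same pair of arcs, since v_1 v_2 and v_(n+1) v_(n+2)
   are edges. *)
Lemma no_three_chords n b1 b2 b3 : b1 < b2 < b3 ->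
  chord_leaves n [:: b1; b2; b3] (fun k => b1 < k < b2) ->
  chord_leaves n [:: b1; b2; b3] (fun k => b2 < k < b3) ->
  chord_leaves n [:: b1; b2; b3] (fun k => (b3 < k) || (k < b1)) -> False.
Proof.
rewrite /chord_leaves !inE => /andP[b12 b23].
case/orP => /and3P[h11 h12 h13]; case/orP => /and3P[h21 h22 h23];
  case/orP => /and3P[h31 h32 h33]; lia.
Qed.

Lemma saltire_claw_contractible_free n : 3 <= n ->
  claw_contractible_free (saltire n n).
Proof.
move=> n_ge3 /contracts_to_map[g [g_surj g_adj g_conn]].
have n_gt1 : 1 < n by lia.
have adjE := adj_saltire _ _ n_gt1.
have N_gt0 : 0 < n + n by lia.
(* Indices are read modulo 2n, so [h] below records the claw vertices met while walking around the
   cycle; its value 0 is the centre. *)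
pose v k : saltire n n := Ordinal (ltn_pmod k N_gt0).
have vE k : k < n + n -> v k = k :> nat by move=> ?; rewrite /= modn_small.
have vK (x : saltire n n) : v x = x by apply: val_inj; apply: vE.
have v_adj k : adj (v k) (v k.+1).
  by apply: saltire_adj_succ => //=; rewrite -addn1 -modnDml addn1.
pose h k : nat := g (v k).
(* A leaf of the claw is adjacent to the centre only. *)
have h_step k : h k != 0 -> h k.+1 != h k -> h k.+1 = 0.
  move=> hk hk1; have gk : g (v k) != g (v k.+1).
    by apply: contraNneq hk1; rewrite /h => ->.
  have := g_adj _ _ (v_adj k) gk.
  by rewrite claw_adj -/(h k) -/(h k.+1) (negPf hk); case: (h k.+1).
have centre_between a b : a < b -> h a != 0 -> h b != 0 -> h a != h b ->
    exists2 i, a < i < b & h i = 0.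
  move=> ab ha hb ab'; have [i iP [iE i1E]] := change_between (ltnW ab) ab'.
  have i0 : h i.+1 = 0 by apply: h_step; rewrite iE.
  exists i.+1 => //; have : i.+1 != b by apply: contraNneq hb => <-; rewrite i0.
  lia.
have hN k : h (k + (n + n)) = h k.
  by congr (nat_of_ord (g _)); apply: val_inj; rewrite /= modnDr.
(* One representative of each leaf class, sorted along the cycle. *)
have [b1 [b2 [b3 [bP [hb1 hb2 hb3] [hb12 hb23 hb31]]]]] : exists b1 b2 b3,
    [/\ [&& b1 < b2, b2 < b3 & b3 < n + n],
        [/\ h b1 != 0, h b2 != 0 & h b3 != 0]
      & [/\ h b1 != h b2, h b2 != h b3 & h b3 != h b1]].
  have ex (i : nat) : i < 4 -> exists2 b, b < n + n & h b = i.
    move=> i4; have [x xE] := g_surj (Ordinal i4 : claw).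
    by exists x => //; rewrite /h vK xE.
  have [c1 c1P c1E] := ex 1 isT; have [c2 c2P c2E] := ex 2 isT.
  have [c3 c3P c3E] := ex 3 isT.
  have n12 : c1 <> c2 by move=> cE; move: c1E; rewrite cE c2E.
  have n23 : c2 <> c3 by move=> cE; move: c2E; rewrite cE c3E.
  have n31 : c3 <> c1 by move=> cE; move: c3E; rewrite cE c1E.
  have [c12|c21] := leqP c1 c2; have [c23|c32] := leqP c2 c3;
    have [c13|c31] := leqP c1 c3;
  first [ lia
        | exists c1, c2, c3; rewrite c1E c2E c3E; split=> //; lia
        | exists c1, c3, c2; rewrite c1E c2E c3E; split=> //; lia
        | exists c2, c1, c3; rewrite c1E c2E c3E; split=> //; lia
        | exists c2, c3, c1; rewrite c1E c2E c3E; split=> //; lia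
        | exists c3, c1, c2; rewrite c1E c2E c3E; split=> //; lia
        | exists c3, c2, c1; rewrite c1E c2E c3E; split=> //; lia ].
have [c1 c1P c1E] : exists2 i, b1 < i < b2 & h i = 0.
  by apply: centre_between => //; lia.
have [c2 c2P c2E] : exists2 i, b2 < i < b3 & h i = 0.
  by apply: centre_between => //; lia.
(* The last arc wraps around: the walk goes from [b3] to [b1] one period later, and the index found
   is reduced if it passes 2n. *)
have [c3 c3P c3E] : exists2 i, (b3 < i < n + n) || (i < b1) & h i = 0.
  have [||||i iP iE] := centre_between b3 (b1 + (n + n)); rewrite ?hN //.
    by lia.
  have [iN|iN] := ltnP i (n + n); first by exists i => //; lia.
  by exists (i - (n + n)); [lia | rewrite -hN subnK].
have centre_neq (x : saltire n n) : g x = 0 :> nat ->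
    (x : nat) \notin [:: b1; b2; b3].
  move=> xE; rewrite !inE !negb_or; apply/and3P.
  split; [move: hb1 | move: hb2 | move: hb3];
  by apply: contraNneq => <-; rewrite /h vK xE.
(* The centre class is connected, so a path inside it from [A] to the complement of [A] has an edge
   leaving [A]. *)
have exit (A : pred nat) i j : A i -> ~~ A j -> i < n + n -> j < n + n ->
    h i = 0 -> h j = 0 -> exists u w : saltire n n,
      [/\ adj u w, A u, ~~ A w, g u = 0 :> nat & g w = 0 :> nat].
  move=> Ai Aj iN jN hi hj.
  have /connectP[p] : connect (fun u v => adj u v && (g u == g v)) (v i) (v j).
    by apply: g_conn; apply: val_inj; apply: (etrans hi (Logic.eq_sym hj)).
  have : A (v i) by rewrite vE.
  have : g (v i) = 0 :> nat by [].
  elim: p (v i) => [|y p IHp] x /= gx Ax.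
    by move=> _ xE; rewrite -xE vE // (negPf Aj) in Ax.
  case/andP=> /andP[xy /eqP gxy] yp ypE.
  have [Ay|Ay] := boolP (A y); first by apply: IHp yp ypE => //; rewrite -gxy.
  by exists x, y; split=> //; rewrite -gxy.
have cross (A : pred nat) i j : A i -> ~~ A j -> i < n + n -> j < n + n ->
    h i = 0 -> h j = 0 ->
    (forall k, k \notin [:: b1; b2; b3] -> k.+1 \notin [:: b1; b2; b3] ->
      A k = A k.+1) ->
    (0 \notin [:: b1; b2; b3] -> (n + n).-1 \notin [:: b1; b2; b3] ->
      A 0 = A (n + n).-1) ->
    chord_leaves n [:: b1; b2; b3] A.
  move=> Ai Aj iN jN hi hj stepA closeA.
  have [u [w [uw Au Aw /centre_neq uB /centre_neq wB]]] :=
    exit A i j Ai Aj iN jN hi hj.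
  rewrite adjE in uw; exact: edge_leaves_chord stepA closeA Au Aw uB wB uw.
(* For each arc, the centre vertex found in it and one found in another arc force a chord to leave
   it. *)
apply: (no_three_chords (n := n) (b1 := b1) (b2 := b2) (b3 := b3)); first lia.
- apply: (cross (fun k => b1 < k < b2) c1 c2) => // [|||k|];
  move: c1P c2P bP; rewrite ?inE; clear; lia.
- apply: (cross (fun k => b2 < k < b3) c2 c1) => // [|||k|];
  move: c1P c2P bP; rewrite ?inE; clear; lia.
- apply: (cross (fun k => (b3 < k) || (k < b1)) c3 c1) => // [||||k|];
  move: c1P c3P bP; rewrite ?inE; clear; lia.
Qed.

(** * Splitting sums over words *)

Section TupleSums.
Local Open Scope ring_scope.
Variables (R : nmodType) (T : finType).
Implicit Type F : seq T -> R.

Lemma sum_tuple0 F : \sum_(t : 0.-tuple T) F t = F [::].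
Proof.
rewrite (big_pred1 [tuple]) // => t.
by rewrite [t]tuple0 /= eqxx.
Qed.

Lemma sum_tupleS n F :
  \sum_(t : n.+1.-tuple T) F t = \sum_x \sum_(t : n.-tuple T) F (x :: t).
Proof.
rewrite pair_big /= (reindex (fun p : T * n.-tuple T => [tuple of p.1 :: p.2])) //=.
exists (fun t => (thead t, [tuple of behead t])) => [[x t] _|t _] /=.
  by rewrite theadE; congr pair; apply: val_inj.
by rewrite -tuple_eta.
Qed.

Lemma sum_tuple_cat m n F :
  \sum_(t : (m + n).-tuple T) F t =
  \sum_(s : m.-tuple T) \sum_(t : n.-tuple T) F (s ++ t).
Proof.
elim: m F => [|m IHm] F.
  by rewrite (sum_tuple0 (fun s => \sum_(t : n.-tuple T) F (s ++ t))).
rewrite (sum_tupleS (m + n) F).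
rewrite (sum_tupleS m (fun s => \sum_(t : n.-tuple T) F (s ++ t))).
by apply: eq_bigr => x _; rewrite (IHm (fun s => F (x :: s))).
Qed.

Lemma sum_ffun_tuple n (P : pred {ffun 'I_n -> T}) (F : {ffun 'I_n -> T} -> R) :
  \sum_(c | P c) F c =
  \sum_(t : n.-tuple T | P [ffun i => tnth t i]) F [ffun i => tnth t i].
Proof.
rewrite (reindex (fun t : n.-tuple T => [ffun i => tnth t i])) //=.
exists (fun c => [tuple c i | i < n]) => [t|c] _.
  by apply: eq_from_tnth => i; rewrite tnth_mktuple ffunE.
by apply/ffunP => i; rewrite ffunE tnth_mktuple.
Qed.

End TupleSums.

(** * Proper colourings of the saltire graph as cyclic words *)

Lemma cycle_nthP (T : Type) (d : T) (e : rel T) (s : seq T) :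
  reflect (forall i, i < size s -> e (nth d s i) (nth d s (i.+1 %% size s)))
          (cycle e s).
Proof.
case: s => [|x p]; first by left.
have nthE i : i < size (x :: p) ->
    (nth d (x :: rcons p x) i = nth d (x :: p) i) *
    (nth d (rcons p x) i = nth d (x :: p) (i.+1 %% size (x :: p))).
  move=> ip; split; first by rewrite -rcons_cons nth_rcons ip.
  move: ip; rewrite nth_rcons /= ltnS leq_eqVlt => /orP[/eqP->|ip].
    by rewrite modnn ltnn eqxx.
  by rewrite modn_small ?ltnS // ip.
apply: (iffP (pathP d)) => eP i; have := eP i; rewrite size_rcons => eQ ip.
  by have := eQ ip; rewrite !nthE.
by rewrite !nthE //; apply: eQ.
Qed.

Lemma proper_saltire n k (d : 'I_k) (t : (n + n).-tuple 'I_k) : 1 < n ->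
  proper (G := saltire n n) [ffun i => tnth t i] =
  [&& cycle (fun a b => a != b) t, nth d t 0 != nth d t n
     & nth d t 1 != nth d t n.+1].
Proof.
move=> n_gt1; have N_gt0 : 0 < n + n by lia.
have properP : reflect (forall x y : saltire n n, adj x y -> nth d t x != nth d t y)
    (proper (G := saltire n n) [ffun i => tnth t i]).
  apply: (iffP forallP) => tP x; last first.
    by apply/forallP => y; apply/implyP => /tP; rewrite !ffunE !(tnth_nth d).
  move=> y; have /forallP/(_ y)/implyP := tP x.
  by rewrite !ffunE !(tnth_nth d).
have adjE := adj_saltire _ _ n_gt1.
apply/properP/and3P => [tP|[/(cycle_nthP d) cyc c0 c1] x y].
  have tP' i j (iN : i < n + n) (jN : j < n + n) := tP (Ordinal iN) (Ordinal jN).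
  split.
  - apply/(cycle_nthP d) => i; rewrite size_tuple => iN.
    apply: (tP' _ _ iN (ltn_pmod _ N_gt0)); exact: saltire_adj_succ.
  - have nN : n < n + n by lia.
    by apply: (tP' _ _ N_gt0 nN); rewrite adjE /= !eqxx !orbT.
  - have [N1 nN] : 1 < n + n /\ n.+1 < n + n by lia.
    by apply: (tP' _ _ N1 nN); rewrite adjE /= !eqxx !orbT.
rewrite size_tuple in cyc.
have {}cyc i : i < n + n ->
    nth d t i != nth d t (if i == (n + n).-1 then 0 else i.+1).
  move=> iN; have := cyc i iN; case: ifP => [/eqP->|iE].
    by rewrite prednK // modnn.
  by rewrite modn_small //; move/eqP: iE; lia.
(* Both sides are symmetric in [x] and [y], so each edge may be read in its listed direction. *)
wlog: x y / [|| y == x.+1 :> nat, (x == (n + n).-1 :> nat) && (y == 0 :> nat),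
    (x == 0 :> nat) && (y == n :> nat) | (x == 1 :> nat) && (y == n.+1 :> nat)].
  move=> IH; rewrite /= /sym_adj => /andP[xy /orP[r|r]].
    by apply: IH => //; rewrite /= /sym_adj xy r.
  by rewrite eq_sym; apply: IH => //; rewrite /= /sym_adj eq_sym xy r.
have := cyc x (ltn_ord x); have := ltn_ord y.
move=> yN cx /or4P[/eqP yE|/andP[xE /eqP yE]|/andP[/eqP xE /eqP yE]|
  /andP[/eqP xE /eqP yE]] _.
- by move: cx; rewrite -yE; case: ifP => // xE; move: xE; lia.
- by move: cx; rewrite xE yE.
- by rewrite xE yE.
- by rewrite xE yE.
Qed.

(** * Transfer along the two paths *)

Section PathColourings.
Local Open Scope ring_scope.
Variables (F : comNzRingType) (n : nat) (w : 'I_n -> F).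

(* The weighted count of proper colourings of the m interior vertices of a path
   with end colours i and j. *)
Definition chain m (i j : 'I_n) : F :=
  \sum_(s : m.-tuple 'I_n)
    (path (fun a b => a != b) i (rcons s j))%:R * \prod_(a <- s) w a.

Lemma chain0 i j : chain 0 i j = (i != j)%:R.
Proof.
rewrite /chain (sum_tuple0 (fun s =>
  (path (fun a b => a != b) i (rcons s j))%:R * \prod_(a <- s) w a)).
by rewrite big_nil mulr1 /= andbT.
Qed.

Lemma chainS m i j :
  chain m.+1 i j = \sum_a (i != a)%:R * w a * chain m a j.
Proof.
rewrite /chain (sum_tupleS m (fun s =>
  (path (fun a b => a != b) i (rcons s j))%:R * \prod_(a <- s) w a)).
apply: eq_bigr => a _; rewrite big_distrr; apply: eq_bigr => s _ /=.
by rewrite big_cons -mulnb natrM; ring.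
Qed.

(** Here n = m + 2, and the colours around the cycle form the word [x y s u v t]: [x], [y], [u], [v]
    colour v_1, v_2, v_(n+1), v_(n+2), while [s] and [t] are the interiors of the two paths. The
    chords give [x != u] and [y != v]. *)
Lemma sum_proper_saltire m :
  \sum_(c : {ffun saltire m.+2 m.+2 -> 'I_n} | proper c) \prod_v w (c v) =
  \sum_x \sum_y \sum_u \sum_v
    [&& x != y, u != v, x != u & y != v]%:R *
    (w y * w u * chain m y u) * (w v * w x * chain m v x).
Proof.
(* The head of the word only serves as default for [nth]; all words summed over are nonempty. *)
pose prop (s : seq 'I_n) := if s isn't d :: _ then false else
  [&& cycle (fun a b => a != b) s, nth d s 0 != nth d s m.+2
     & nth d s 1 != nth d s m.+3].
pose W s : F := (prop s)%:R * \prod_(a <- s) w a.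
transitivity (\sum_(t : (m.+2 + m.+2).-tuple 'I_n) W t).
  rewrite (@sum_ffun_tuple F 'I_n (m.+2 + m.+2)) big_mkcond; apply: eq_bigr => t _.
  rewrite /W.
  have -> : prop t = proper (G := saltire m.+2 m.+2) [ffun i => tnth t i].
    case tE: (tval t) (size_tuple t) => [//|d s] _.
    by rewrite (proper_saltire d) // tE.
  case: ifP => _; rewrite ?mul0r // mul1r big_tuple.
  by apply: eq_bigr => i _; rewrite ffunE.
rewrite sum_tuple_cat.
rewrite (sum_tupleS m.+1 (fun s => \sum_(t : m.+2.-tuple 'I_n) W (s ++ t))).
apply: eq_bigr => x _.
rewrite (sum_tupleS m (fun s => \sum_(t : m.+2.-tuple 'I_n) W (x :: (s ++ t)))).
apply: eq_bigr => y _.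
under eq_bigr => s _ do rewrite (sum_tupleS m.+1 (fun t => W (x :: y :: s ++ t))).
rewrite exchange_big /=; apply: eq_bigr => u _.
under eq_bigr => s _ do rewrite (sum_tupleS m (fun t => W (x :: y :: s ++ u :: t))).
rewrite exchange_big /=; apply: eq_bigr => v _.
rewrite /chain [w y * w u * _]big_distrr [w v * w x * _]big_distrr /= -mulrA.
rewrite big_distrl big_distrr /=; apply: eq_bigr => s _.
rewrite !big_distrr /=; apply: eq_bigr => t _.
rewrite /W.
have -> : prop (x :: y :: s ++ u :: v :: t) =
  [&& x != y, u != v, x != u & y != v] && (path (fun a b => a != b) y (rcons s u)
    && path (fun a b => a != b) v (rcons t x)).
  rewrite /prop /= rcons_cat /= cat_path /= !rcons_path !nth_cat size_tuple.
  rewrite ltnn ltnNge leqnSn subnn subSnn /=.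
  case: (x != y); case: (u != v); case: (x != u); case: (y != v) => //=;
  by rewrite ?andbF ?andbT ?andbA.
rewrite !big_cons big_cat !big_cons -!mulnb !natrM /=; ring.
Qed.

End PathColourings.

(** * Path and 4-cycle sums with roots of unity as weights *)

Section RootOfUnitySums.
Local Open Scope ring_scope.
Variables (F : fieldType) (n : nat) (z : F).
Hypothesis prim_z : n.-primitive_root z.

Local Notation "''w_' i" := (z ^+ (i : 'I_n))
  (at level 8, i at level 2, format "''w_' i").
Local Notation chainz := (chain (fun a => 'w_a)).

Lemma sum_prim_root_exp k : (0 < k < n)%N -> \sum_(i < n) 'w_i ^+ k = 0.
Proof.
move=> /andP[k_gt0 kn]; have zk1 : z ^+ k - 1 != 0.
  by rewrite subr_eq0 -(prim_order_dvd prim_z) gtnNdvd.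
apply: (mulfI zk1); rewrite mulr0.
transitivity ((z ^+ k) ^+ n - 1).
  by rewrite [RHS]subrX1; congr (_ * _); apply: eq_bigr => i _; rewrite exprAC.
by rewrite exprAC (prim_expr_order prim_z) expr1n subrr.
Qed.

(** The sum is the complete homogeneous polynomial h_m in the two end weights. The induction writes
    the sum over [a != i] as the full sum minus the term at [i]. *)
Lemma chainE m i j : (m < n)%N ->
  chainz m i j =
  (-1) ^+ m *
  (\sum_(k < m.+1) 'w_i ^+ k * 'w_j ^+ (m - k) - (i == j)%:R * 'w_i ^+ m).
Proof.
elim: m i => [|m IHm] i mn.
  by rewrite chain0 big_ord1 !expr0 !mulr1 mul1r; case: eqP; rewrite ?subrr ?subr0.
rewrite chainS (eq_bigr (fun a => 'w_a * chainz m a j -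
  (i == a)%:R * ('w_a * chainz m a j))); last first.
  by move=> a _; case: eqP => _ /=; ring.
rewrite sumrB [X in _ - X](bigD1 i) //= eqxx /=.
rewrite [X in _ - (_ + X)]big1 ?addr0; last first.
  by move=> a ai; rewrite eq_sym (negPf ai) mul0r.
rewrite IHm ?(ltnW mn) //.
(* All exponents of ['w_a] in the h_m part lie strictly between 0 and n, so these power sums vanish
   and only the Kronecker term remains. *)
have -> : \sum_a 'w_a * chainz m a j = (-1) ^+ m.+1 * 'w_j ^+ m.+1.
  under eq_bigr => a _ do rewrite IHm ?(ltnW mn) // mulrCA mulrBr big_distrr /=.
  rewrite -big_distrr sumrB /= exchange_big big1 /=; last first.
    move=> k _; under eq_bigr => a _ do rewrite mulrA -exprS.
    rewrite -big_distrl /= sum_prim_root_exp ?mul0r //; have := ltn_ord k; lia.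
  rewrite (bigD1 j) //= eqxx /= big1 ?addr0; last first.
    by move=> a /negPf->; rewrite mul0r mulr0.
  by rewrite !exprS; ring.
rewrite [in RHS]big_ord_recl /= subn0.
under [in RHS]eq_bigr => k _ do rewrite /bump /= add1n subSS exprS -mulrA.
rewrite -big_distrr /= !exprS; ring.
Qed.

(** For i = j, h_(n-2) has n - 1 equal terms and one is subtracted. For i != j, h_(n-2) is a
    quotient of differences, and n-th powers being 1 leave (w_j - w_i) / (w_i - w_j) = -1. *)
Lemma chain_weight i j : (1 < n)%N ->
  'w_i * 'w_j * chainz (n - 2) i j =
  (-1) ^+ n * (n.-1%:R * (i == j)%:R - 1).
Proof.
move=> n_gt1; rewrite chainE; last by lia.
have [m nE] : exists m, n = m.+2 by exists (n - 2)%N; lia.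
have -> : (n - 2 = m)%N by lia.
have w1 (k : 'I_n) : 'w_k ^+ m.+2 = 1.
  by rewrite exprAC -nE (prim_expr_order prim_z) expr1n.
have -> : (-1) ^+ n = (-1) ^+ m :> F by rewrite nE !exprS; ring.
have -> : n.-1 = m.+1 by lia.
rewrite mulrCA; congr (_ * _).
have [-> /= |ij] := eqVneq i j.
  have -> : \sum_(k < m.+1) 'w_j ^+ k * 'w_j ^+ (m - k) = 'w_j ^+ m *+ m.+1.
    rewrite (eq_bigr (fun=> 'w_j ^+ m)) ?sumr_const ?card_ord // => k _.
    by rewrite -exprD subnKC // -ltnS.
  transitivity ('w_j ^+ m.+2 * m%:R); last by rewrite w1 -natr1 /= ?mulr1n; ring.
  by rewrite !exprS -mulr_natr -natr1 /= ?mulr1n; ring.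
have wij : 'w_i - 'w_j != 0.
  by rewrite subr_eq0 (eq_prim_root_expr prim_z) !modn_small.
rewrite /= !mulr0n mul0r subr0 mulr0 sub0r; apply: (mulfI wij).
have /(congr1 (fun x => - ('w_i * 'w_j * x))) := subrXX 'w_j 'w_i m.+1.
under eq_bigr => k _ do rewrite /= mulrC.
set S := \sum_(k < m.+1) _ => SE.
transitivity (- ('w_i * 'w_j * (('w_j - 'w_i) * S))); first ring.
transitivity ('w_i ^+ m.+2 * 'w_j - 'w_j ^+ m.+2 * 'w_i); last by rewrite !w1; ring.
by rewrite -SE !exprS; ring.
Qed.

(** In the 4-cycle, [y] and [u] are opposite corners, each adjacent to both [x] and [v]; once [x]
    and [v] are fixed they vary independently. *)
Lemma sum_root_colourings : (1 < n)%N ->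
  \sum_(x < n) \sum_(y < n) \sum_(u < n) \sum_(v < n)
    [&& x != y, u != v, x != u & y != v]%:R *
    ('w_y * 'w_u * chainz (n - 2) y u) *
    ('w_v * 'w_x * chainz (n - 2) v x) =
  - (n * n.-1 * (n - 2))%:R.
Proof.
move=> n_gt1.
(* The path weight without its sign (-1)^n, which cancels between the two paths. *)
pose c (i j : 'I_n) : F := n.-1%:R * (i == j)%:R - 1.
pose K (x v i : 'I_n) : F := ((x != i) && (i != v))%:R.
transitivity (\sum_x \sum_v c v x * \sum_y (K x v y * \sum_u K x v u * c y u)).
  apply: eq_bigr => x _; rewrite (eq_bigr (fun y => \sum_v \sum_u
      c v x * (K x v y * (K x v u * c y u)))).
    rewrite exchange_big; apply: eq_bigr => v _; rewrite big_distrr.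
    by apply: eq_bigr => y _; rewrite !big_distrr.
  move=> y _; rewrite exchange_big; apply: eq_bigr => v _; apply: eq_bigr => u _.
  rewrite !chain_weight // -/(c y u) -/(c v x).
  rewrite /K; case: (x != y); case: (y != v); case: (x != u); case: (u != v);
    rewrite /= ?mul0r ?mulr0 ?mul1r //.
  by rewrite mulrACA -expr2 sqrr_sign mul1r mulrC.
have Ksum x v (G : 'I_n -> F) : \sum_i K x v i * G i =
    \sum_(i | (x != i) && (i != v)) G i.
  by rewrite [RHS]big_mkcond; apply: eq_bigr => i _; rewrite /K; case: ifP;
     rewrite ?mul1r ?mul0r.
have cardK x v : #|[pred i : 'I_n | (x != i) && (i != v)]| = (n - (v != x).+1)%N.
  have := cardC (pred2 x v); rewrite card_ord card2 eq_sym.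
  rewrite (eq_card (B := [pred i | (x != i) && (i != v)])); last first.
    by move=> i; rewrite !inE negb_or [x == i]eq_sym.
  by move/(congr1 (subn^~ (v != x).+1)); rewrite /= addKn.
(* With k colours allowed for [y] and for [u], the sum is k (n - 1 - k), where k = n - 1 if v = x
   and k = n - 2 otherwise. *)
have inner x v : \sum_y (K x v y * \sum_u K x v u * c y u) =
    if v == x then 0 else (n - 2)%:R.
  set k := (n - (v != x).+1)%N.
  rewrite Ksum (eq_bigr (fun=> n.-1%:R - k%:R)).
    rewrite sumr_const cardK -/k /k; case: eqP => _ /=.
      by rewrite subn1 subrr mul0rn.
    have -> : n.-1 = (n - 2).+1 by lia.
    by rewrite -natr1 addrAC subrr add0r.
  move=> y yP; rewrite Ksum sumrB (bigD1 y) //= eqxx mulr1 big1 ?addr0.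
    by rewrite sumr_const cardK.
  by move=> u /andP[_ uy]; rewrite eq_sym (negPf uy) mulr0.
under eq_bigr => x _ do under eq_bigr => v _ do rewrite inner.
(* For each [x], the n - 1 values [v != x] contribute [c v x] = -1 times n - 2. *)
rewrite (eq_bigr (fun=> - (n.-1 * (n - 2))%:R)).
  rewrite sumr_const card_ord mulNrn -mulrnA.
  by congr (- _%:R); rewrite mulnC mulnA.
move=> x _; rewrite (bigD1 x) //= eqxx mulr0 add0r.
rewrite (eq_bigr (fun=> - (n - 2)%:R)).
  rewrite sumr_const cardC1 card_ord mulNrn mulnC -mulrnA //.
by move=> v /negPf vx; rewrite /c vx mulr0 sub0r mulN1r.
Qed.

End RootOfUnitySums.

(** * Evaluation of symmetric functions at the n-th roots of unity *)

Section SpecialisationAtRootsOfUnity.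
Local Open Scope ring_scope.

Lemma mmap_mesym (R : nzRingType) (S : comNzRingType) (f : {rmorphism R -> S}) n
    (v : 'I_n -> S) k : mmap f v (mesym n R k) = (mesym n S k).@[v].
Proof.
rewrite !mesymE !raddf_sum /=; apply: eq_bigr => h _.
by rewrite mmapX mevalX.
Qed.

Lemma csf_poly_homog (G : sgraph) k : csf_poly G k \is #|G|.-homog for mdeg.
Proof.
apply: rpred_sum => c _.
suff -> : \prod_(v : G) 'X_(c v) = 'X_[\sum_(v : G) U_(c v)%MM] :> {mpoly rat[k]}.
  rewrite dhomogX /= mdeg_sum (eq_bigr (fun=> 1%N)) ?sum1_card //.
  by move=> v _; rewrite mdeg1.
by rewrite mprodXE.
Qed.

Lemma esym_poly_homog la k : esym_poly la k \is (sumn la).-homog for mdeg.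
Proof.
rewrite /esym_poly; elim: la => [|i s IHs]; first by rewrite big_nil dhomog1.
rewrite big_cons /=; apply: dhomogM => //.
rewrite mesymE; apply: rpred_sum => h /eqP hi.
by rewrite dhomogX /= mdeg_mesym1 hi.
Qed.

Variables (F : numFieldType) (n : nat) (z : F).
Hypothesis prim_z : n.-primitive_root z.

Let v (i : 'I_n) : F := z ^+ i.
Let ev : {mpoly rat[n]} -> F := mmap ratr v.

(** Vieta's formulas for the product of the X - z^i, which is X^n - 1. *)
Lemma mesym_prim_root (k : 'I_n.+1) :
  (-1) ^+ k * (mesym n F k).@[v] = ('X^n - 1 : {poly F})`_(n - k).
Proof.
have := mroots_coeff [tuple v i | i < n] k.
rewrite big_tuple (eq_bigr (fun i : 'I_n => 'X - (z ^+ i)%:P)); last first.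
  by move=> i _; rewrite tnth_mktuple.
have := factor_Xn_sub_1 prim_z; rewrite big_mkord => -> ->.
by congr (_ * _); apply: meval_eq => i; rewrite tnth_mktuple.
Qed.

Lemma mesym_prim_root0 k : (0 < k)%N -> k != n -> (mesym n F k).@[v] = 0.
Proof.
move=> k_gt0 kn; have [nk|kn'] := ltnP n k; first by rewrite mesym_geqnE // meval0.
apply: (mulfI (x := (-1) ^+ k)); first by rewrite signr_eq0.
rewrite (mesym_prim_root (Ordinal (kn' : (k < n.+1)%N))) mulr0 coefB coefXn coef1.
have [-> ->] : (n - k == n)%N = false /\ (n - k == 0)%N = false by split; lia.
by rewrite subrr.
Qed.

(** The constant term gives (-1)^n e_n = -1; squaring removes the sign. *)
Lemma mesym_prim_root_sqr : (mesym n F n).@[v] ^+ 2 = 1.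
Proof.
have n_gt0 := prim_order_gt0 prim_z.
rewrite -[LHS]mul1r -[X in X * _](sqrr_sign F n) -exprMn.
rewrite (mesym_prim_root ord_max) /= subnn coefB coefXn coef1 eq_sym.
by rewrite (gtn_eqF n_gt0) sub0r sqrrN expr1n.
Qed.

(** A part different from n, nonzero since [la] is a partition, makes the product vanish; otherwise
    [la] is (n, n) and the value is e_n^2 = 1. *)
Lemma eval_esym_ge0 la : is_partition la -> sumn la = (n + n)%N ->
  0 <= ev (esym_poly la n).
Proof.
case/andP=> _ la0 la_sum.
have -> : ev (esym_poly la n) = \prod_(i <- la) (mesym n F i).@[v].
  by rewrite /ev /esym_poly rmorph_prod; apply: eq_bigr => i _; apply: mmap_mesym.
have [la_n|/allPn[i ila i_n]] := boolP (all (pred1 n) la); last first.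
  have i_gt0 : (0 < i)%N by rewrite lt0n; apply: contraNneq la0 => <-.
  by rewrite (perm_big _ (perm_to_rem ila)) big_cons /= mesym_prim_root0 // mul0r.
have n_gt0 := prim_order_gt0 prim_z.
move: la_sum; rewrite (all_pred1P _ _ la_n) sumn_nseq => la_sum.
have -> : size la = 2 by apply/eqP; rewrite -(eqn_pmul2l n_gt0) la_sum muln2 addnn.
by rewrite !big_cons big_nil mulr1 -expr2 mesym_prim_root_sqr ler01.
Qed.

(** The given expansion may list terms of any degree. X_G is homogeneous, so projecting onto degree
    2n before evaluating preserves it and discards the other terms, whose values could be
    negative. *)
Lemma e_positive_eval_ge0 (G : sgraph) : #|G| = (n + n)%N -> e_positive (csf G) ->
  0 <= \sum_(c : {ffun G -> 'I_n} | proper c) \prod_x z ^+ c x.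
Proof.
move=> cardG [s [c [sP c_ge0 /(_ n) /= csfE]]].
have <- : ev (csf_poly G n) =
    \sum_(c : {ffun G -> 'I_n} | proper c) \prod_x z ^+ c x.
  rewrite /ev /csf_poly rmorph_sum; apply: eq_bigr => d _.
  by rewrite rmorph_prod; apply: eq_bigr => x _ /=; rewrite mmapX mmap1U.
rewrite -(pihomog_dE (csf_poly_homog G n)) csfE.
pose phi p := ev (pihomog mdeg #|G| p).
have phiD : {morph phi : p q / p + q}.
  by move=> p q; rewrite /phi pihomogD /ev mmapD.
have phi0 : phi 0 = 0 by rewrite /phi pihomog0 /ev mmap0.
rewrite -/(phi _) (big_morph phi phiD phi0) big_seq.
apply: sumr_ge0 => la las; rewrite /phi linearZ /ev /= mmapZ.
apply: mulr_ge0; first by rewrite ler0q.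
have [la_sum|la_sum] := eqVneq (sumn la) #|G|; last first.
  by rewrite (pihomog_ne0 la_sum (esym_poly_homog _ _)) mmap0.
rewrite -la_sum pihomog_dE ?esym_poly_homog //.
by apply: eval_esym_ge0; rewrite ?la_sum //; apply: (allP sP).
Qed.

End SpecialisationAtRootsOfUnity.

Lemma saltire_not_e_positive n : 3 <= n -> ~ e_positive (csf (saltire n n)).
Proof.
case: n => [|[|m]] // n_ge3.
have [z prim_z] := C_prim_root_exists (isT : 0 < m.+2).
move=> /(e_positive_eval_ge0 prim_z); rewrite card_ord => /(_ erefl).
rewrite (sum_proper_saltire (fun a : 'I_m.+2 => z ^+ a)%R).
have := sum_root_colourings prim_z isT.
rewrite (_ : m.+2 - 2 = m) ?subSS ?subn0 // => ->.
(* The sum is -(m + 2) (m + 1) m, which is nonnegative only for m = 0, that is n = 2. *)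
by rewrite oppr_ge0 lern0 !muln_eq0 /= => /eqP m0; rewrite m0 in n_ge3.
Qed.

Theorem theorem3p5 (n : nat) (hn : 3 <= n) :
  claw_contractible_free (saltire n n) /\ ~ e_positive (csf (saltire n n)).
Proof.
split; first exact: saltire_claw_contractible_free.
exact: saltire_not_e_positive.
Qed.
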